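(* Let $\mathcal{G}=(\mathcal{V},\mathcal{E})$ be a connected undirected edge-transitive graph with vertex set $\mathcal{V}=\{1,\ldots,n\}$, $n\ge 2$. Let $L$ be its Laplacian matrix with eigenvalues $\lambda_1(L)\ge\lambda_2(L)\ge\cdots\ge\lambda_{n-1}(L)\ge\lambda_n(L)=0$, and let $\nu_{\max}=\max_{i\in\mathcal{V}}\nu_i$ be the maximum valency of the vertices. Assign the same transition probability $\alpha$ to all the edges, so that the transition probability matrix is $P=I-\alpha L$. Then the optimal solution of the fastest mixing Markov chain (FMMC) problem on $\mathcal{G}$ is given by $$\alpha^\star=\min\left\{\frac{1}{\nu_{\max}},\ \frac{2}{\lambda_1(L)+\lambda_{n-1}(L)}\right\},\qquad \mu^\star=\max\left\{1-\frac{\lambda_{n-1}(L)}{\nu_{\max}},\ \frac{\lambda_1(L)-\lambda_{n-1}(L)}{\lambda_1(L)+\lambda_{n-1}(L)}\right\};$$ that is, the matrix $P^\star=I-\alpha^\star L$ is feasible for the FMMC problem, it minimizes $\mu(P)$ over all feasible $P$, and the minimum value is $\mu(P^\star)=\mu^\star$.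
   Context: The graph is finite and simple. The feasible set of the FMMC problem is $$\mathcal{C}=\{P\in\mathbb{R}^{n\times n} : P\ge 0 \text{ (elementwise)},\ P\mathbf{1}=\mathbf{1},\ P=P^T,\ P_{ij}=0 \text{ for } i\neq j,\ \{i,j\}\notin\mathcal{E}\},$$ where $\mathbf{1}$ is the all-ones vector. For $P\in\mathcal{C}$ with eigenvalues $1=\lambda_1(P)\ge\cdots\ge\lambda_n(P)\ge -1$ (with multiplicity), let $\mu(P)=\max_{i=2,\ldots,n}|\lambda_i(P)|=\max\{\lambda_2(P),-\lambda_n(P)\}$. The FMMC problem is to minimize $\mu(P)$ over $P\in\mathcal{C}$. The valency (degree) of vertex $i$ is $\nu_i$; the adjacency matrix $A$ has $A_{ij}=1$ if $\{i,j\}\in\mathcal{E}$ and $0$ otherwise; the Laplacian is $L=\mathrm{Diag}(\nu_1,\ldots,\nu_n)-A$. Eigenvalues are listed in non-increasing order with multiplicity. The graph is edge-transitive if its automorphism group (the permutations $\sigma$ of $\mathcal{V}$ preserving $\mathcal{E}$) acts transitively on $\mathcal{E}$ via $\sigma(\{i,j\})=\{\sigma(i),\sigma(j)\}$. *)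

(* Defs.v *)
From mathcomp Require Import all_boot all_order all_fingroup all_algebra.
From mathcomp Require Import polyrcf.

Set Implicit Arguments.
Unset Strict Implicit.
Unset Printing Implicit Defensive.

Import Order.TTheory GRing.Theory Num.Theory.
Local Open Scope ring_scope.

(* A finite simple graph on n vertices is a symmetric irreflexive adjacency   *)
(* relation on 'I_n; symmetry and irreflexivity are hypotheses of statements. *)

Definition edges (n : nat) (e : rel 'I_n) : {set {set 'I_n}} :=
  [set [set p.1; p.2] | p : 'I_n * 'I_n & e p.1 p.2].

Definition connected_graph (n : nat) (e : rel 'I_n) : Prop :=
  forall i j, connect e i j.

Definition graph_aut (n : nat) (e : rel 'I_n) : {set 'S_n} :=
  [set s : 'S_n | [forall i, [forall j, e (s i) (s j) == e i j]]].

(* 'P^* maps a set E of vertices and a permutation s to the image s @: E. *)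
Definition edge_transitive (n : nat) (e : rel 'I_n) : Prop :=
  [transitive graph_aut e, on edges e | 'P^*].

Definition valency (n : nat) (e : rel 'I_n) (i : 'I_n) : nat :=
  #|[set j | e i j]|.

Definition max_valency (n : nat) (e : rel 'I_n) : nat :=
  (\max_(i < n) valency e i)%N.

Definition adjacency (R : rcfType) (n : nat) (e : rel 'I_n) : 'M[R]_n :=
  \matrix_(i, j) (e i j)%:R.

Definition laplacian (R : rcfType) (n : nat) (e : rel 'I_n) : 'M[R]_n :=
  diag_mx (\row_i (valency e i)%:R) - adjacency R e.

(* The real eigenvalues of A in non-increasing order, each repeated according *)
(* to its multiplicity as a root of the characteristic polynomial. When A is  *)
(* symmetric the characteristic polynomial splits, and the list has length n. *)
Definition spectrum (R : rcfType) (n : nat) (A : 'M[R]_n) : seq R :=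
  let p := char_poly A in
  sort >=%R (flatten [seq nseq (mup x p) x | x <- rootsR p]).

(* Indices start at 1, as in lambda_1(A) >= lambda_2(A) >= ... *)
Definition eigval (R : rcfType) (n : nat) (A : 'M[R]_n) (i : nat) : R :=
  (spectrum A)`_i.-1.

Lemma spectrumE (R : rcfType) (n : nat) (A : 'M[R]_n) (s : seq R) :
  char_poly A = \prod_(x <- s) ('X - x%:P) -> spectrum A = sort >=%R s.
Proof.
move=> pE; apply/perm_sortP; [exact: ge_total|exact: ge_trans|exact: ge_anti|].
have p0 : char_poly A != 0 by rewrite monic_neq0 ?char_poly_monic.
apply/allP => /= x _; apply/eqP; rewrite count_flatten.
have <- : mup x (char_poly A) = count_mem x s by rewrite pE mu_prod_XsubC.
rewrite -map_comp sumnE big_map.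
under eq_bigr => y _ do rewrite /= count_nseq /=.
have memE : (x \in rootsR (char_poly A)) = root (char_poly A) x.
  by rewrite -roots_on_rootsR.
have [xr|xr] := boolP (x \in rootsR (char_poly A)).
  rewrite (bigD1_seq x) ?uniq_roots //= eqxx mul1n big1 ?addn0 // => y /negPf yx.
  by rewrite yx mul0n.
rewrite mupNroot -?memE // big_seq big1 // => y yr.
by case: eqVneq => [yx|]; rewrite ?mul0n // -yx yr in xr *.
Qed.

Definition feasible (R : rcfType) (n : nat) (e : rel 'I_n) (P : 'M[R]_n) :
    Prop :=
  [/\ forall i j, 0 <= P i j,
      P *m const_mx 1 = const_mx 1 :> 'cV[R]_n,
      P = P^T
    & forall i j, i != j -> [set i; j] \notin edges e -> P i j = 0].

(* All terms of the maximum are nonnegative, so 0 is a neutral base value. *)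
Definition mu (R : rcfType) (n : nat) (P : 'M[R]_n) : R :=
  \big[Num.max/0]_(2 <= i < n.+1) `|eigval P i|.

Definition fmmc_optimal (R : rcfType) (n : nat) (e : rel 'I_n)
    (P : 'M[R]_n) : Prop :=
  feasible e P /\ forall Q : 'M[R]_n, feasible e Q -> mu P <= mu Q.

(* Main.v *)
Require Import Defs.
From mathcomp Require Import all_boot all_order all_fingroup all_algebra.
From mathcomp Require Import polyrcf complex ring lra.

(* Averaging a feasible Q over the automorphism group G gives a matrix of the *)
(* form I - t L, because G permutes the edges transitively. If x is           *)
(* orthogonal to 1, then x Q x^* is bounded in modulus by mu(Q) |x|^2; the    *)
(* same then holds with I - t L in place of Q. Test vectors for the extreme   *)
(* eigenvalues of L give 1 - t lambda_{n-1} <= mu(Q) and                      *)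
(* t lambda_1 - 1 <= mu(Q), where t nu_max <= 1 by feasibility. Eliminating t *)
(* from these three inequalities gives mu(Q) >= mu^star. Vectors are taken    *)
(* over R[i], where the spectral theorem is available.                        *)

Set Implicit Arguments.
Unset Strict Implicit.
Unset Printing Implicit Defensive.

Import Order.TTheory GRing.Theory Num.Theory.
Local Open Scope ring_scope.

(** The lower bound runs through [feasible_average], which produces t and carries the estimate
    [feasible_rayleigh] over from Q to I - t L, and [mu_lower_bounds], which evaluates it on test
    vectors. In 1 - t lambda_{n-1} <= mu(Q), the constraint t <= 1 / nu_max gives the first term of
    mu^star; a combination with t lambda_1 - 1 <= mu(Q) that cancels t gives the second.

    The bound is attained because, by [mu_affine], mu(I - t L) for t >= 0 is the larger of |1 - t
    lambda_1| and |1 - t lambda_{n-1}|. Since alpha^star is at most 2 / (lambda_1 + lambda_{n-1}),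
    the larger one at alpha^star is 1 - alpha^star lambda_{n-1}, and the minimum in alpha^star
    becomes the maximum in mu^star. *)

Lemma char_poly_conj (F : comNzRingType) n (U V D : 'M[F]_n) :
  V *m U = 1%:M -> char_poly (V *m D *m U) = char_poly D.
Proof.
move=> VU; rewrite /char_poly.
suff -> : char_poly_mx (V *m D *m U) =
    map_mx polyC V *m char_poly_mx D *m map_mx polyC U.
  rewrite !det_mulmx mulrAC -det_mulmx -map_mxM VU map_mx1.
  by rewrite det1 mul1r.
rewrite /char_poly_mx mulmxBr mulmxBl -!map_mxM mul_mx_scalar -scalemxAl.
by rewrite -map_mxM VU map_mx1 scale_scalar_mx mulr1.
Qed.

(** * Spectral theorem with ordered real eigenvalues; quadratic forms over R[i] *)

Section Spectral.
Local Open Scope complex_scope.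
Local Open Scope sesquilinear_scope.
Variable R : rcfType.
Local Notation C := R[i].
Local Notation toC := (map_mx (real_complex R)).

Lemma char_poly_unitary_diag n (A : 'M[R]_n) (U : 'M[C]_n) (d : 'rV[R]_n) :
  U \is unitarymx -> toC A = U^t* *m diag_mx (toC d) *m U ->
  char_poly A = \prod_i ('X - (d 0 i)%:P).
Proof.
move=> Uu AE; apply: (@map_poly_inj _ _ (real_complex R)).
rewrite map_char_poly -[_ ^ _]/(toC A) AE.
rewrite char_poly_conj; last exact/mulmx1C/unitarymxP.
rewrite char_poly_trig ?diag_mx_is_trig // rmorph_prod /=.
by apply: eq_bigr => i _; rewrite !mxE eqxx mulr1n map_polyXsubC.
Qed.

(** Over R[i] the matrix A is hermitian, so it is unitarily diagonalisable with real eigenvalues;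
    its characteristic polynomial therefore splits over R and [spectrumE] applies. Row i of U is an
    eigenvector for [eigval A i.+1]. *)
Lemma spectral_decomposition n (A : 'M[R]_n) : A = A^T ->
  [/\ size (spectrum A) = n,
     forall i j, (i <= j < n)%N -> eigval A j.+1 <= eigval A i.+1
   & exists2 U : 'M[C]_n, U \is unitarymx &
     toC A = U^t* *m diag_mx (toC (\row_i eigval A i.+1)) *m U].
Proof.
move=> Asym.
have Aherm : toC A \is hermsymmx.
  apply: realsym_hermsym; first by apply/is_hermitianmxP; rewrite expr0 scale1r
    map_mx_id // map_trmx -Asym.
  by apply/mxOverP => i j; rewrite mxE complex_real.
have /mxOverP dreal := hermitian_spectral_diag_real Aherm.
have /orthomx_spectralP AE := hermitian_normalmx Aherm.
have := spectral_unitarymx (toC A).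
move: dreal AE; set U := spectralmx _; set d := spectral_diag _ => dreal AE Uu.
rewrite (invmx_unitary Uu) in AE.
pose r i := complex.Re (d 0 i).
have dE i : d 0 i = (r i)%:C by rewrite RRe_real.
have pE : char_poly A = \prod_(x <- codom r) ('X - x%:P).
  rewrite codomE big_map big_enum.
  rewrite (char_poly_unitary_diag (U := U) (d := \row_i r i)) //.
    by apply: eq_bigr => i _; rewrite mxE.
  by rewrite AE; congr (_ *m diag_mx _ *m _); apply/rowP => i; rewrite !mxE.
have sE := spectrumE pE.
have srt : perm_eq (spectrum A) (map_tuple r (ord_tuple n)).
  by rewrite sE perm_sort /= codomE.
have [p spE] := tuple_permP srt.
have evE (i : 'I_n) : eigval A i.+1 = r (p i).
  rewrite /eigval spE /= (nth_map i) ?size_enum_ord // nth_ord_enum.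
  by rewrite tnth_map tnth_ord_tuple.
have sz : size (spectrum A) = n by rewrite spE size_tuple.
split=> //.
  move=> i j /andP[ij jn]; rewrite /eigval /=.
  have := sort_sorted (@ge_total _ R) (codom r); rewrite -sE => srtd.
  have := sorted_leq_nth ge_trans ge_refl 0 srtd.
  by apply; rewrite ?inE ?sz // (leq_ltn_trans ij).
(* The spectral theorem gives the eigenvalues in arbitrary order; p matches them with the sorted
   list, so the rows of U are permuted accordingly. *)
exists (row_perm p U).
  apply/unitarymxP; apply/matrixP => i j; rewrite !mxE.
  have /unitarymxP/matrixP/(_ (p i) (p j)) := Uu; rewrite !mxE => Eij.
  rewrite (inj_eq perm_inj) in Eij; rewrite -Eij; apply: eq_bigr => k _.
  by rewrite !mxE.
rewrite AE; apply/matrixP => i j; rewrite !mul_mx_diag !mxE.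
rewrite (reindex_inj (@perm_inj _ p)); apply: eq_bigr => k _.
by rewrite !mxE evE dE.
Qed.

(** Valued in C, like [qform]: the estimates use the partial order of C, where u <= v means that v -
    u is real and nonnegative. *)
Definition sqnorm n (x : 'rV[C]_n) : C := \sum_i `|x 0 i| ^+ 2.

Definition qform n (A : 'M[R]_n) (x : 'rV[C]_n) : C :=
  (x *m toC A *m x^t*) 0 0.

Lemma sqnorm_ge0 n (x : 'rV[C]_n) : 0 <= sqnorm x.
Proof. by apply: sumr_ge0 => i _; rewrite exprn_ge0. Qed.

Lemma sqnorm_gt0 n (x : 'rV[C]_n) : x != 0 -> 0 < sqnorm x.
Proof.
move=> xn0; rewrite lt0r sqnorm_ge0 andbT; apply: contra_neq xn0 => x0.
apply/rowP => i; rewrite mxE; apply/eqP; rewrite -normr_eq0 -sqrf_eq0.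
by apply/eqP/(psumr_eq0P _ x0) => // j _; rewrite exprn_ge0.
Qed.

Lemma sqnormE n (x : 'rV[C]_n) : sqnorm x = (x *m x^t*) 0 0.
Proof. by rewrite mxE; apply: eq_bigr => i _; rewrite !mxE normCK. Qed.

Lemma unitary_dot n (U : 'M[C]_n) (x y : 'rV[C]_n) : U \is unitarymx ->
  (x *m U^t*) *m (y *m U^t*)^t* = x *m y^t*.
Proof.
move=> Uu; rewrite trmx_mul map_mxM -map_trmx map_trmx trmxCK !mulmxA.
by rewrite mulmxKtV.
Qed.

Lemma sqnorm_unitary n (U : 'M[C]_n) (x : 'rV[C]_n) : U \is unitarymx ->
  sqnorm (x *m U^t*) = sqnorm x.
Proof. by move=> Uu; rewrite !sqnormE unitary_dot. Qed.

Lemma qform_spectral n (A : 'M[R]_n) (U : 'M[C]_n) (d : 'rV[R]_n) x :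
  toC A = U^t* *m diag_mx (toC d) *m U ->
  qform A x = \sum_i (d 0 i)%:C * `|(x *m U^t*) 0 i| ^+ 2.
Proof.
move=> AE; rewrite /qform AE !mulmxA -[_ *m U *m _]mulmxA.
have -> : U *m x^t* = (x *m U^t*)^t* by rewrite trmx_mul map_mxM trmxCK.
rewrite mxE; apply: eq_bigr => i _.
rewrite mul_mx_diag normCK mulrCA mulrA.
by rewrite !mxE.
Qed.

Lemma qformE n (A : 'M[R]_n) (x : 'rV[C]_n) :
  qform A x = \sum_i \sum_j (A i j)%:C * (x 0 i * Num.conj (x 0 j)).
Proof.
rewrite exchange_big /qform mxE; apply: eq_bigr => j _.
rewrite !mxE big_distrl; apply: eq_bigr => i _ /=.
by rewrite !mxE mulrA [_ * x 0 i]mulrC.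
Qed.

(** * Rayleigh bounds for feasible matrices *)

Section Feasible.
Variables (n : nat) (e : rel 'I_n) (Q : 'M[R]_n).
Hypothesis Qf : feasible e Q.

Lemma feasible_row_sum i : \sum_j Q i j = 1.
Proof.
case: Qf => _ /colP /(_ i) + _ _; rewrite !mxE => <-.
by apply: eq_bigr => j _; rewrite !mxE mulr1.
Qed.

Lemma feasible_sym i j : Q i j = Q j i.
Proof. by case: Qf => _ _ /matrixP /(_ i j) + _; rewrite mxE. Qed.

(** Each product satisfies 2 |x_i| |x_j| <= |x_i|^2 + |x_j|^2; weighting by Q_ij and summing gives
    twice the squared norm, as rows and columns of Q sum to 1. *)
Lemma feasible_contraction x : `|qform Q x| <= sqnorm x.
Proof.
have Q0 i j : 0 <= (Q i j)%:C by rewrite ler0c; case: Qf.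
have Q1 i : \sum_j (Q i j)%:C = 1.
  by rewrite -(rmorph_sum (real_complex R)) feasible_row_sum.
rewrite -(ler_pM2l (ltr0n _ 2)) qformE.
have -> : 2 * sqnorm x =
    \sum_i \sum_j (Q i j)%:C * (`|x 0 i| ^+ 2 + `|x 0 j| ^+ 2).
  transitivity (\sum_i \sum_j (Q i j)%:C * `|x 0 i| ^+ 2
      + \sum_i \sum_j (Q i j)%:C * `|x 0 j| ^+ 2).
    rewrite mulr_natl mulr2n; congr (_ + _).
      by apply: eq_bigr => i _; rewrite -big_distrl /= Q1 mul1r.
    rewrite exchange_big; apply: eq_bigr => i _; rewrite -big_distrl /=.
    by under eq_bigr => j _ do rewrite feasible_sym; rewrite Q1 mul1r.
  rewrite -big_split; apply: eq_bigr => i _; rewrite -big_split.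
  by apply: eq_bigr => j _; rewrite mulrDr.
apply: le_trans (ler_wpM2l _ (ler_norm_sum _ _ _)) _ => //.
rewrite big_distrr; apply: ler_sum => i _ /=.
apply: le_trans (ler_wpM2l _ (ler_norm_sum _ _ _)) _ => //.
rewrite big_distrr; apply: ler_sum => j _ /=.
rewrite !normrM norm_conjC ger0_norm // mulrCA ler_wpM2l // mulr_natl.
rewrite -subr_ge0 -addrAC -sqrrB.
by rewrite real_exprn_even_ge0 // realB // normr_real.
Qed.

Lemma le_eigval_mu (A : 'M[R]_n) (i : 'I_n) : (0 < i)%N ->
  `|eigval A i.+1| <= mu A.
Proof.
move=> i0; apply: (@le_bigmax_seq _ _ _ _ _ i.+1) => //.
by rewrite mem_index_iota; apply/andP; split; [exact: i0|rewrite ltnS].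
Qed.

(** In an eigenbasis of Q, every eigenvalue but the first is bounded by mu Q in modulus, so it
    suffices that x has no first coordinate. This is shown when mu Q < 1; otherwise
    [feasible_contraction] is already strong enough. *)
Lemma feasible_rayleigh (x : 'rV[C]_n) : \sum_i x 0 i = 0 ->
  `|qform Q x| <= (mu Q)%:C * sqnorm x.
Proof.
move=> sx; have [mu1|mu1] := leP 1 (mu Q).
  apply: le_trans (feasible_contraction x) _.
  by rewrite ler_peMl ?sqnorm_ge0 // -[1]/(1%:C) lecR.
have Qsym : Q = Q^T by case: Qf.
have [_ _ [U Uu QE]] := spectral_decomposition Qsym.
(* As mu Q < 1, the eigenvalue 1 is simple and heads the spectrum; hence x,   *)
(* being orthogonal to 1, has no component along the first eigenvector.       *)
pose o : 'rV[C]_n := const_mx 1.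
pose c := x *m U^t*; pose d := o *m U^t*.
have oQ : o *m toC Q = o.
  apply/rowP => j; rewrite !mxE -[RHS](rmorph1 (real_complex R)).
  rewrite -(feasible_row_sum j) rmorph_sum; apply: eq_bigr => i _.
  by rewrite !mxE mul1r feasible_sym.
have dE i : d 0 i * (eigval Q i.+1)%:C = d 0 i.
  have : d *m diag_mx (toC (\row_i eigval Q i.+1)) = d.
    rewrite -[LHS](mulmxtVK _ Uu); congr (_ *m _).
    by rewrite -[RHS]oQ QE !mulmxA.
  by move=> /rowP/(_ i); rewrite mul_mx_diag !mxE.
have d0 (i : 'I_n) : (0 < i)%N -> d 0 i = 0.
  move=> i0; have /eqP := dE i; rewrite -subr_eq0 -{2}[d 0 i]mulr1 -mulrBr.
  rewrite mulf_eq0 => /orP[/eqP //|]; rewrite subr_eq0 => /eqP /complexI e1.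
  by move: mu1; rewrite ltNge -e1 (le_trans (ler_norm _)) // le_eigval_mu.
have cd : c *m d^t* = 0.
  rewrite unitary_dot //; apply/rowP => i; rewrite !mxE -[RHS]sx.
  by apply: eq_bigr => j _; rewrite ord1 !mxE rmorph1 mulr1.
have dcE j : d^t* j 0 = Num.conj (d 0 j).
  by rewrite [LHS]mxE [X in Num.conj X = _]mxE.
(* The coordinates d of the vector 1 vanish away from index 0, and d is nonzero, so c d^* = 0 forces
   the coordinate of x at index 0 to vanish. *)
have c0 (i : 'I_n) : i = 0%N :> nat -> c 0 i = 0.
  move=> i0; have /rowP/(_ 0) := cd.
  rewrite [RHS]mxE [LHS]mxE (bigD1 i) //= big1 => [|j ji]; last first.
    rewrite dcE d0 ?rmorph0 ?mulr0 // lt0n.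
    by apply: contra ji => /eqP ji; apply/eqP/val_inj; rewrite /= ji i0.
  rewrite dcE addr0 => /eqP; rewrite mulf_eq0 => /orP[/eqP //|].
  rewrite conjC_eq0 => /eqP di0.
  have : d *m U = o by rewrite mulmxKtV.
  have -> : d = 0.
    apply/rowP => j; rewrite [RHS]mxE.
    have [j0|/d0 //] := posnP j; suff -> : j = i by exact: di0.
    by apply: val_inj; rewrite /= i0.
  rewrite mul0mx => /rowP/(_ i); rewrite !mxE => /esym/eqP.
  by rewrite oner_eq0.
rewrite (qform_spectral _ QE) -(sqnorm_unitary x Uu) -/c.
rewrite big_distrr; apply: le_trans (ler_norm_sum _ _ _) _.
apply: ler_sum => i _; rewrite normrM normrX normr_id.
have [i0|i0] := posnP i; first by rewrite c0 // normr0 expr0n /= !mulr0.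
rewrite ler_wpM2r ?exprn_ge0 // mxE.
have -> : `|(eigval Q i.+1)%:C| = (`|eigval Q i.+1|)%:C.
  by rewrite normc_def /= expr0n /= addr0 sqrtr_sqr.
by rewrite lecR le_eigval_mu.
Qed.
End Feasible.

Lemma qform_affine n (A : 'M[R]_n) (t : R) x :
  qform (1%:M - t *: A) x = sqnorm x - t%:C * qform A x.
Proof.
rewrite /qform map_mxB map_mx1 map_mxZ mulmxBr mulmxBl mulmx1.
by rewrite -scalemxAr -scalemxAl sqnormE !mxE.
Qed.

(** * Test vectors for the extreme eigenvalues *)

Section TestVectors.
Variables (n : nat) (A : 'M[R]_n) (Asym : A = A^T).

Lemma qform_eigval (i : 'I_n) : exists x : 'rV[C]_n,
  [/\ x != 0, qform A x = (eigval A i.+1)%:C * sqnorm x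
    & x *m toC A = (eigval A i.+1)%:C *: x].
Proof.
have [_ _ [U Uu AE]] := spectral_decomposition Asym.
exists (row i U).
have xA : row i U *m toC A = (eigval A i.+1)%:C *: row i U.
  rewrite AE !mulmxA -row_mul (unitarymxP Uu) row1 -rowE.
  by rewrite row_diag_mx -scalemxAl -rowE !mxE.
split=> //.
  apply/eqP => x0; have /row_unitarymxP/(_ i i) := Uu.
  by rewrite x0 linear0l eqxx => /esym/eqP; rewrite oner_eq0.
by rewrite /qform xA -scalemxAl mxE -sqnormE.
Qed.

(* The span of the last two eigenvectors meets the hyperplane orthogonal      *)
(* to 1, so 0 need not be a simple eigenvalue of A.                           *)
Lemma qform_low_vector : (1 < n)%N -> exists x : 'rV[C]_n,
  [/\ x != 0, \sum_i x 0 i = 0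
    & qform A x <= (eigval A n.-1)%:C * sqnorm x].
Proof.
move=> n1.
have [_ ev_le [U Uu AE]] := spectral_decomposition Asym.
have n2 : (n.-2 < n)%N by case: (n) n1 => [|[|k]].
have n3 : (n.-1 < n)%N by case: (n) n1.
have iE : n.-2.+1 = n.-1 by case: (n) n1 => [|[|k]].
(* Counting from 0, i and j are the positions of lambda_{n-1} and lambda_n. *)
pose i := Ordinal n2; pose j := Ordinal n3.
have ij : i != j by rewrite -val_eqE /= -iE ltn_eqF.
pose s k := \sum_l U k l.
(* With s_k the entry sum of the k-th eigenvector u_k, the combination s_j u_i - s_i u_j has entry
   sum 0; it could vanish only if s_j = 0, and then u_j itself serves. *)
have [c [c0 cij cs]] : exists c : 'rV[C]_n, [/\ c != 0,
    forall k, k != i -> k != j -> c 0 k = 0 & \sum_k c 0 k * s k = 0].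
  have [sj|sj] := eqVneq (s j) 0.
    exists (delta_mx 0 j); split.
    - by apply/eqP => /rowP/(_ j)/eqP; rewrite !mxE !eqxx oner_eq0.
    - by move=> k _ /negPf kj; rewrite mxE kj.
    - rewrite (bigD1 j) //= sj mulr0 add0r big1 // => k /negPf kj.
      by rewrite mxE kj mul0r.
  exists (s j *: delta_mx 0 i - s i *: delta_mx 0 j); split.
  - apply/eqP => /rowP/(_ i)/eqP.
    by rewrite !mxE !eqxx (negPf ij) mulr0 subr0 mulr1 (negPf sj).
  - by move=> k /negPf ki /negPf kj; rewrite !mxE ki kj !mulr0 subr0.
  - rewrite (bigD1 i) //= (bigD1 j) 1?eq_sym //= big1 ?addr0.
      rewrite !mxE !eqxx (negPf ij) eq_sym (negPf ij) /= !mulr0 !mulr1.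
      by rewrite subr0 sub0r mulNr mulrC subrr.
    move=> k /andP[/negPf ki /negPf kj].
    by rewrite !mxE ki kj !mulr0 subr0 mul0r.
have cU : (c *m U) *m U^t* = c by rewrite mulmxtVK.
exists (c *m U); split.
- by apply: contra_neq c0 => cU0; rewrite -cU cU0 mul0mx.
- under eq_bigr => k _ do rewrite mxE.
  rewrite exchange_big -[RHS]cs; apply: eq_bigr => k _.
  by rewrite -big_distrr.
rewrite (qform_spectral _ AE) -(sqnorm_unitary (c *m U) Uu) cU.
rewrite big_distrr; apply: ler_sum => k _ /=.
have [->|ki] := eqVneq k i.
  by rewrite mxE /= iE.
have [->|kj] := eqVneq k j; last by rewrite cij // normr0 expr0n /= !mulr0.
rewrite ler_wpM2r ?exprn_ge0 // mxE lecR.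
have -> : n.-1 = i.+1 by rewrite /= iE.
by apply: ev_le; rewrite /= n3 -iE leqnSn.
Qed.
End TestVectors.

(** * The spectrum of I - t A *)

Section AffineSpectrum.
Variables (n : nat) (A : 'M[R]_n) (t : R).
Hypotheses (Asym : A = A^T) (t0 : 0 <= t).

(** For t >= 0 the map x |-> 1 - t x is nonincreasing, so reversing the image list restores the
    order. *)
Lemma spectrum_affine :
  spectrum (1%:M - t *: A) = rev [seq 1 - t * x | x <- spectrum A].
Proof.
have [sz _ [U Uu AE]] := spectral_decomposition Asym.
pose f x := 1 - t * x; rewrite -/f.
have pE : char_poly (1%:M - t *: A) =
    \prod_(x <- rev (map f (spectrum A))) ('X - x%:P).
  rewrite (perm_big (map f (spectrum A))) ?perm_rev // big_map (big_nth 0) sz.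
  rewrite big_mkord.
  rewrite (char_poly_unitary_diag (U := U) (d := \row_i f (eigval A i.+1))) //.
    by apply: eq_bigr => i _; rewrite mxE.
  rewrite map_mxB map_mx1 map_mxZ AE.
  have {1}<- : U^t* *m U = 1%:M by exact/mulmx1C/unitarymxP.
  rewrite scalemxAl -mulmxBl -{1}[U^t*]mulmx1 scalemxAr -mulmxBr.
  congr (_ *m _ *m _); apply/matrixP => i j; rewrite !mxE.
  case: eqVneq => _; rewrite ?mulr0n ?mulr0 ?subr0 //.
  by rewrite !mulr1n rmorphB rmorph1 rmorphM.
rewrite (spectrumE pE); apply: sorted_sort; first exact: ge_trans.
rewrite rev_sorted sorted_map.
have : sorted >=%R (spectrum A) by apply/sort_sorted/ge_total.
apply: sub_sorted => x y /= xy.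
by rewrite lerD2l lerN2 ler_wpM2l.
Qed.

Lemma eigval_affine i : (i < n)%N ->
  eigval (1%:M - t *: A) i.+1 = 1 - t * eigval A (n - i).
Proof.
have [sz _ _] := spectral_decomposition Asym.
move=> i_n; rewrite /eigval spectrum_affine nth_rev size_map sz //.
have lt_n : (n - i.+1 < n)%N by rewrite ltn_subrL (leq_ltn_trans _ i_n).
by rewrite (nth_map 0) ?sz // subnS.
Qed.

(** Dropping the first eigenvalue of I - t A drops lambda_n(A). The others are 1 - t lambda_m(A)
    with 1 <= m <= n - 1; they lie between the two extreme ones, and the modulus on an interval is
    largest at an endpoint. *)
Lemma mu_affine : (1 < n)%N -> mu (1%:M - t *: A) =
  Num.max `|1 - t * eigval A 1| `|1 - t * eigval A n.-1|.
Proof.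
move=> n1; have [_ ev_le _] := spectral_decomposition Asym.
apply/eqP; rewrite eq_le; apply/andP; split; last first.
  rewrite ge_max; apply/andP; split.
    have nE : n.-1.+1 = n by case: (n) n1.
    have := @eigval_affine n.-1; rewrite nE => /(_ (leqnn n)).
    have -> : (n - n.-1 = 1)%N by rewrite -{1}nE subSnn.
    move=> <-; apply: (@le_bigmax_seq _ _ _ _ _ n) => //.
    by rewrite mem_index_iota n1 ltnS leqnn.
  rewrite -subn1 -eigval_affine //.
  by apply: (@le_bigmax_seq _ _ _ _ _ 2%N); rewrite ?mem_index_iota.
rewrite /mu big_seq; apply: bigmax_le => [|k].
  by rewrite le_max normr_ge0.
rewrite mem_index_iota => /andP[k2 kn].
have kE : k.-1.+1 = k by case: (k) k2.
rewrite -kE eigval_affine ?kE //.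
set m := (n - k.-1)%N.
have [m1 m2] : (0 < m)%N /\ (m <= n.-1)%N.
  by rewrite /m subn_gt0 kE -[n.-1]subn1 leq_sub2l // -ltnS kE.
have mE : m.-1.+1 = m by case: (m) m1.
have lo : eigval A n.-1 <= eigval A m.
  have nE : n.-2.+1 = n.-1 by case: (n) n1 => [|[|]].
  rewrite -mE -nE; apply: ev_le; rewrite -ltnS mE nE m2 /=.
  by case: (n) n1 => [|[|]].
have hi : eigval A m <= eigval A 1.
  rewrite -mE; apply: ev_le; rewrite /= mE (leq_trans m2) //.
  exact: leq_pred.
have lo' := ler_wpM2l t0 lo; have hi' := ler_wpM2l t0 hi.
rewrite le_max; case: (ger0P (1 - t * eigval A m)) => _.
  apply/orP; right; apply: le_trans (ler_norm _).
  by rewrite lerD2l lerN2.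
apply/orP; left; rewrite -normrN; apply: le_trans (ler_norm _).
by rewrite lerN2 lerD2l lerN2.
Qed.
End AffineSpectrum.

(** * The Laplacian and averaging over the automorphism group *)

Section Graph.
Variables (n : nat) (e : rel 'I_n).
Hypotheses (e_sym : symmetric e) (e_irr : irreflexive e).

Lemma mem_edges i j : ([set i; j] \in edges e) = e i j.
Proof.
apply/imsetP/idP => [[[k l] + ijE]|eij]; last by exists (i, j); rewrite ?inE.
rewrite inE /= => ekl.
have kl : k != l by apply: contraTneq ekl => ->; rewrite e_irr.
have : k \in [set i; j] by rewrite ijE set21.
have : l \in [set i; j] by rewrite ijE set22.
rewrite !inE => /orP[]/eqP lE /orP[]/eqP kE; move: ekl kl;
  by rewrite lE kE ?eqxx // e_sym.
Qed.

Lemma graph_aut_group_set : group_set (graph_aut e).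
Proof.
apply/group_setP; split.
  by rewrite inE; apply/forallP => i; apply/forallP => j; rewrite !perm1.
move=> s t; rewrite !inE => /forallP sP /forallP tP.
apply/forallP => i; apply/forallP => j; rewrite !permM.
by rewrite (eqP (forallP (tP _) _)) (eqP (forallP (sP _) _)).
Qed.
Canonical graph_aut_group := Group graph_aut_group_set.

Lemma graph_autE s i j : s \in graph_aut e -> e (s i) (s j) = e i j.
Proof. by rewrite inE => /forallP/(_ i)/forallP/(_ j)/eqP. Qed.

Lemma valencyE i : (valency e i)%:R = \sum_j (e i j)%:R :> R.
Proof.
rewrite -natr_sum; congr (_%:R).
rewrite /valency -sum1_card big_mkcond; apply: eq_bigr => j _.
by rewrite inE; case: (e i j).
Qed.

Lemma laplacianE i j :
  laplacian R e i j = (if i == j then (valency e i)%:R else 0) - (e i j)%:R.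
Proof. by rewrite !mxE; case: eqVneq. Qed.

Lemma laplacian_sym : laplacian R e = (laplacian R e)^T.
Proof.
apply/matrixP => i j; rewrite [RHS]mxE !laplacianE e_sym eq_sym.
by case: eqVneq => // ->.
Qed.

Lemma laplacian_row_sum i : \sum_j laplacian R e i j = 0.
Proof.
under eq_bigr => j _ do rewrite laplacianE.
rewrite sumrB -valencyE (bigD1 i) //= eqxx big1 ?addr0 ?subrr // => j /negPf ij.
by rewrite eq_sym ij.
Qed.

Lemma affine_mxE (M : 'M[R]_n) (t : R) i j :
  (1%:M - t *: M) i j = (i == j)%:R - t * M i j.
Proof. by rewrite !mxE. Qed.

Lemma feasible_laplacian (t : R) : 0 <= t -> t * (max_valency e)%:R <= 1 ->
  feasible e (1%:M - t *: laplacian R e).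
Proof.
move=> t0 t1.
have PE i j : (1%:M - t *: laplacian R e) i j =
    if i == j then 1 - t * (valency e i)%:R else t * (e i j)%:R.
  rewrite affine_mxE laplacianE.
  by case: eqVneq => [->|_]; rewrite ?e_irr ?subr0 // !sub0r mulrN opprK.
split.
- move=> i j; rewrite PE; case: eqP => _; last by rewrite mulr_ge0.
  rewrite subr_ge0 (le_trans _ t1) // ler_wpM2l // ler_nat.
  exact: (leq_bigmax i).
- apply/colP => i; rewrite !mxE.
  under eq_bigr => j _ do rewrite [const_mx _ _ _]mxE mulr1 affine_mxE.
  rewrite sumrB -big_distrr /= laplacian_row_sum mulr0 subr0.
  rewrite (bigD1 i) //= eqxx big1 ?addr0 // => j /negPf ji.
  by rewrite eq_sym ji.
- apply/matrixP => i j; rewrite [RHS]mxE !PE e_sym eq_sym.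
  by case: eqVneq => // ->.
- move=> i j /negPf ij; rewrite mem_edges => /negPf eij.
  by rewrite PE ij eij mulr0.
Qed.

(** The average B of Q over the automorphisms is symmetric, vanishes off the edges and is constant
    on them; its row sums 1 then fix the diagonal, so B = I - t L with t the common edge value. Its
    quadratic form at x averages that of Q over permuted copies of x, which keep the norm and the
    zero entry sum. *)
Lemma feasible_average (Q : 'M[R]_n) :
  edge_transitive e -> feasible e Q ->
  exists t : R, [/\ 0 <= t, t * (max_valency e)%:R <= 1 &
    forall x : 'rV[C]_n, \sum_i x 0 i = 0 ->
      `|qform (1%:M - t *: laplacian R e) x| <= (mu Q)%:C * sqnorm x].
Proof.
move=> e_trans Qf.
pose G := graph_aut e; pose g : R := #|G|%:R.
have g0 : 0 < g by rewrite ltr0n (cardG_gt0 graph_aut_group).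
pose B : 'M[R]_n := \matrix_(i, j) (g^-1 * \sum_(s in G) Q (s i) (s j)).
have BE i j : B i j = g^-1 * \sum_(s in G) Q (s i) (s j) by rewrite mxE.
have Bsym i j : B i j = B j i.
  rewrite !BE; congr (_ * _); apply: eq_bigr => s _.
  exact: feasible_sym Qf _ _.
have Binv s i j : s \in G -> B (s i) (s j) = B i j.
  move=> sG; rewrite !BE; congr (_ * _).
  rewrite [RHS](reindex_inj (mulgI s)); apply: eq_big => [u|u _].
    by rewrite (groupMl (G := graph_aut_group)).
  by rewrite !permM.
have B0 i j : i != j -> ~~ e i j -> B i j = 0.
  move=> ij eij; rewrite BE big1 ?mulr0 // => s sG.
  case: Qf => _ _ _; apply; first by rewrite (inj_eq perm_inj).
  by rewrite mem_edges graph_autE.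
have B1 i : \sum_j B i j = 1.
  under eq_bigr => j _ do rewrite BE.
  rewrite -big_distrr /= exchange_big.
  rewrite (eq_bigr (fun=> 1)) => [|s _]; last first.
    by rewrite -(feasible_row_sum Qf (s i)) [RHS](reindex_inj (@perm_inj _ s)).
  by rewrite sumr_const mulVf // gt_eqF.
have Bge0 i j : 0 <= B i j.
  rewrite BE mulr_ge0 ?invr_ge0 ?(ltW g0) //; apply: sumr_ge0 => s _.
  by case: Qf.
(* Transitivity states that the edge set is the orbit of one of its members, so an edge exists. *)
have [_ /imsetP[[i0 j0] /[!inE]/= e0 ->] _] := imsetP e_trans.
pose t := B i0 j0.
have Be i j : e i j -> B i j = t.
  move=> eij.
  have := atransP2 (G := graph_aut_group) e_trans
    (x := [set i0; j0]) (y := [set i; j]).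
  rewrite !mem_edges => /(_ e0 eij)[s sG] /=.
  rewrite /setact imsetU1 imset_set1 /= /aperm => ijE.
  (* Edges are unordered, so s may exchange the endpoints; the symmetry of B covers that case. *)
  have [[-> ->]|[-> ->]] : (i = s i0 /\ j = s j0) \/ (i = s j0 /\ j = s i0).
    have ij : i != j by apply: contraTneq eij => ->; rewrite e_irr.
    have : i \in [set s i0; s j0] by rewrite -ijE set21.
    have : j \in [set s i0; s j0] by rewrite -ijE set22.
    rewrite !inE => /orP[]/eqP jE /orP[]/eqP iE; move: ij;
      by rewrite ?iE ?jE ?eqxx //; auto.
  by rewrite Binv.
  by rewrite Bsym Binv.
have BL : B = 1%:M - t *: laplacian R e.
  apply/matrixP => i j.
  have Boff k l : k != l -> B k l = t * (e k l)%:R.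
    move=> kl; have [ekl|ekl] := boolP (e k l); first by rewrite Be ?mulr1.
    by rewrite B0 ?mulr0.
  rewrite affine_mxE laplacianE; case: eqVneq => [->|ij]; last first.
    by rewrite Boff // !sub0r mulrN opprK.
  rewrite e_irr subr0 valencyE -[X in X - _](B1 j) (bigD1 j) //=.
  rewrite [X in t * X](bigD1 j) //= e_irr add0r big_distrr /=.
  rewrite -addrA -sumrB big1 ?addr0 // => k kj.
  by rewrite Boff 1?eq_sym // subrr.
exists t; split; first exact: Bge0.
  have [i ->] : exists i, max_valency e = valency e i.
    have [|i _ iE] := @eq_bigmax_cond _ (predT : pred 'I_n) (valency e).
      by apply/card_gt0P; exists i0.
    by exists i; rewrite -iE.
  (* The diagonal entry 1 - t nu_max at a vertex of maximum valency is nonnegative. *)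
  have := Bge0 i i; rewrite BL affine_mxE laplacianE.
  by rewrite eqxx e_irr subr0 subr_ge0.
move=> x sx; rewrite -BL.
have -> : qform B x = g^-1%:C * \sum_(s in G) qform Q (\row_i x 0 ((s^-1)%g i)).
  rewrite qformE big_distrr /=.
  transitivity (\sum_i \sum_j \sum_(s in G)
      g^-1%:C * ((Q (s i) (s j))%:C * (x 0 i * Num.conj (x 0 j)))).
    apply: eq_bigr => i _; apply: eq_bigr => j _.
    by rewrite BE rmorphM rmorph_sum -mulrA big_distrl big_distrr.
  under [LHS]eq_bigr => i _ do rewrite exchange_big.
  rewrite [LHS]exchange_big; apply: eq_bigr => s _ /=.
  rewrite qformE [in RHS](reindex_inj (@perm_inj _ s)) big_distrr.
  apply: eq_bigr => i _ /=.
  rewrite [in RHS](reindex_inj (@perm_inj _ s)) big_distrr.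
  by apply: eq_bigr => j _ /=; rewrite !mxE !permK.
rewrite normrM ger0_norm ?ler0c ?invr_ge0 ?(ltW g0) //.
rewrite fmorphV ler_pdivrMl; last by rewrite ltcR.
rewrite rmorph_nat mulr_natl -sumr_const.
apply: le_trans (ler_norm_sum _ _ _) _; apply: ler_sum => s _.
have -> : sqnorm x = sqnorm (\row_i x 0 ((s^-1)%g i)).
  rewrite /sqnorm (reindex_inj (@perm_inj _ (s^-1)%g)).
  by apply: eq_bigr => i _; rewrite mxE.
apply: (feasible_rayleigh Qf); rewrite -[RHS]sx.
rewrite [RHS](reindex_inj (@perm_inj _ (s^-1)%g)).
by apply: eq_bigr => i _; rewrite mxE.
Qed.
End Graph.

(** * Signs of the Laplacian eigenvalues and lower bounds on mu *)

Section Bounds.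
Variables (n : nat) (e : rel 'I_n).
Hypotheses (n_gt1 : (1 < n)%N) (e_sym : symmetric e) (e_irr : irreflexive e).
Hypothesis e_trans : edge_transitive e.
Let L : 'M[R]_n := laplacian R e.

Lemma edge_transitive_edge : exists i j, e i j.
Proof.
by have [_ /imsetP[[i j] /[!inE]/= e0 _] _] := imsetP e_trans; exists i, j.
Qed.

Lemma max_valency_gt0 : (0 < max_valency e)%N.
Proof.
have [i [j eij]] := edge_transitive_edge.
apply: leq_trans (leq_bigmax i); apply/card_gt0P; exists j.
by rewrite inE.
Qed.

(** I - L / nu_max is feasible, hence a contraction for the quadratic form; on an eigenvector this
    reads |1 - lambda / nu_max| <= 1. *)
Lemma laplacian_eigval_ge0 (i : 'I_n) : 0 <= eigval L i.+1.
Proof.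
have [x [x0 Lx _]] := qform_eigval (laplacian_sym e_sym) i.
have nu0 : 0 < (max_valency e)%:R :> R by rewrite ltr0n max_valency_gt0.
pose t : R := (max_valency e)%:R^-1.
have t0 : 0 < t by rewrite invr_gt0.
have tnu : t * (max_valency e)%:R <= 1 by rewrite mulVf // gt_eqF.
have := feasible_contraction (feasible_laplacian e_sym e_irr (ltW t0) tnu) x.
have -> : qform (1%:M - t *: laplacian R e) x =
    (1 - t * eigval L i.+1)%:C * sqnorm x.
  by rewrite qform_affine Lx rmorphB rmorph1 rmorphM mulrBl mul1r mulrA.
rewrite normrM [`|sqnorm x|]ger0_norm ?sqnorm_ge0 // ger_pMl ?sqnorm_gt0 //.
move=> /(le_trans (real_ler_norm _)); rewrite complex_real eqxx => /(_ isT).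
rewrite -(rmorph1 (real_complex R)).
by rewrite lecR gerBl pmulr_rge0.
Qed.

(** If the largest eigenvalue were 0, all would be, so L = 0; but L has the entry -1 at an edge. *)
Lemma laplacian_eigval1_gt0 : 0 < eigval L 1.
Proof.
have Lsym := laplacian_sym e_sym.
have [_ ev_le [U Uu LE]] := spectral_decomposition Lsym.
have ge0 := laplacian_eigval_ge0.
rewrite lt_def (ge0 (Ordinal (ltnW n_gt1))) andbT; apply/eqP => b0.
have L0 : toC L = 0.
  rewrite LE; suff -> : \row_i eigval L i.+1 = 0 :> 'rV[R]_n.
    by rewrite map_mx0 linear0 mulmx0 mul0mx.
  apply/rowP => i; rewrite !mxE; apply/eqP; rewrite eq_le ge0 andbT -b0.
  by apply: ev_le => /=.
have [i [j eij]] := edge_transitive_edge.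
have /matrixP/(_ i j) := L0; rewrite [LHS]mxE laplacianE eij [RHS]mxE.
have /negPf-> : i != j by apply: contraTneq eij => ->; rewrite e_irr.
by move/complexI/eqP; rewrite sub0r oppr_eq0 oner_eq0.
Qed.

Lemma mu_lower_bounds (Q : 'M[R]_n) : feasible e Q ->
  exists t : R, [/\ t * (max_valency e)%:R <= 1,
    1 - t * eigval L n.-1 <= mu Q & t * eigval L 1 - 1 <= mu Q].
Proof.
move=> Qf; have Lsym := laplacian_sym e_sym.
have [t [t0 tnu tQ]] := feasible_average e_sym e_irr e_trans Qf.
exists t; split=> //.
  have [x [x0 sx Lx]] := qform_low_vector Lsym n_gt1.
  have xgt0 := sqnorm_gt0 x0.
  rewrite -lecR -(ler_pM2r xgt0); apply: le_trans (tQ x sx).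
  have Px : (1 - t * eigval L n.-1)%:C * sqnorm x <=
      qform (1%:M - t *: L) x.
    rewrite qform_affine rmorphB rmorph1 rmorphM mulrBl mul1r lerD2l lerN2.
    by rewrite -mulrA ler_wpM2l ?ler0c.
  (* In C, z <= |z| requires z to be real; here z is comparable with a real number by [Px]. *)
  apply: (le_trans Px (real_ler_norm _)); rewrite -(ler_real Px).
  by rewrite realM ?complex_real // gtr0_real.
have [x [x0 Lx xL]] := qform_eigval Lsym (Ordinal (ltnW n_gt1)).
have b0 := laplacian_eigval1_gt0.
(* Since L annihilates 1, summing the entries of x L = lambda_1 x gives lambda_1 times the entry sum
   of x equal to 0, and lambda_1 > 0. *)
have sx : \sum_i x 0 i = 0.
  have : (eigval L 1)%:C * \sum_i x 0 i = 0.
    transitivity (\sum_j (x *m toC L) 0 j).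
      by rewrite xL big_distrr; apply: eq_bigr => j _; rewrite mxE.
    under eq_bigr => j _ do rewrite mxE.
    rewrite exchange_big big1 // => i _; rewrite -big_distrr /=.
    rewrite (eq_bigr (fun j => (L i j)%:C)) => [|j _]; last by rewrite mxE.
    by rewrite -(rmorph_sum (real_complex R)) laplacian_row_sum mulr0.
  move/eqP; rewrite mulf_eq0 => /orP[|/eqP //].
  by move/eqP/complexI/eqP; rewrite gt_eqF.
have xgt0 := sqnorm_gt0 x0.
rewrite -lecR -(ler_pM2r xgt0); apply: le_trans (tQ x sx).
have -> : qform (1%:M - t *: L) x = (1 - t * eigval L 1)%:C * sqnorm x.
  by rewrite qform_affine Lx rmorphB rmorph1 rmorphM mulrBl mul1r mulrA.
rewrite normrM [`|sqnorm x|]gtr0_norm // ler_pM2r // -normrN.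
rewrite -(rmorphN (real_complex R)) opprB.
by apply: real_ler_norm; rewrite complex_real.
Qed.
End Bounds.
End Spectral.

(** * Attainment and optimality *)

Theorem theorem3p1 (R : rcfType) (n : nat) (e : rel 'I_n)
    (n_ge2 : (2 <= n)%N) (e_sym : symmetric e) (e_irr : irreflexive e)
    (e_conn : connected_graph e) (e_trans : edge_transitive e) :
  let L : 'M[R]_n := laplacian R e in
  let nu_max : R := (max_valency e)%:R in
  let lambda1 : R := eigval L 1 in
  let lambdan1 : R := eigval L n.-1 in
  let alpha : R := Num.min (1 / nu_max) (2 / (lambda1 + lambdan1)) in
  let mu_star : R := Num.max (1 - lambdan1 / nu_max)
                       ((lambda1 - lambdan1) / (lambda1 + lambdan1)) in
  let P : 'M[R]_n := 1%:M - alpha *: L in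
  fmmc_optimal e P /\ mu P = mu_star.
Proof.
move=> L nu b a alpha mu_star P.
have Lsym := laplacian_sym R e_sym.
have b0 : 0 < b by apply: laplacian_eigval1_gt0.
have nE : n.-2.+1 = n.-1 by case: (n) n_ge2 => [|[|]].
have n2 : (n.-2 < n)%N by rewrite nE; case: (n) n_ge2.
have a0 : 0 <= a.
  rewrite /a -nE.
  exact: (laplacian_eigval_ge0 R e_sym e_irr e_trans (Ordinal n2)).
have ab : a <= b.
  rewrite /a /b -nE; have [_ ev_le _] := spectral_decomposition Lsym.
  exact: ev_le.
have nu0 : 0 < nu by rewrite ltr0n max_valency_gt0.
have s0 : 0 < b + a by rewrite ltr_wpDr.
have alpha0 : 0 <= alpha by rewrite le_min !divr_ge0 // ltW.
have alphanu : alpha * nu <= 1.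
  by rewrite -ler_pdivlMr // ge_min lexx.
have Pf : feasible e P by exact: feasible_laplacian.
have starE : (b - a) / (b + a) = 1 - 2 / (b + a) * a.
  by field; rewrite gt_eqF.
have muP : mu P = mu_star.
  rewrite mu_affine // -/a -/b /mu_star.
  (* From alpha (b + a) <= 2 follows alpha b - 1 <= 1 - alpha a, so the eigenvalue of L that decides
     mu P is a. *)
  have hi : `|1 - alpha * b| <= 1 - alpha * a.
    have := ler_wpM2l alpha0 ab.
    have : alpha * (b + a) <= 2 by rewrite -ler_pdivlMr // ge_min lexx orbT.
    by rewrite ler_norml; lra.
  rewrite [`|1 - alpha * a|]ger0_norm; last exact: le_trans (normr_ge0 _) hi.
  rewrite max_r // starE (_ : a / nu = 1 / nu * a); last by rewrite mul1r mulrC.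
  (* As a >= 0, the map t |-> 1 - t a turns the minimum defining alpha into the maximum. *)
  rewrite /alpha; case: (leP (1 / nu)) => [h|/ltW h];
    [rewrite max_l|rewrite max_r];
    by rewrite ?lerD2l ?lerN2 ?ler_wpM2r.
split=> //; split=> // Q Qf.
have [t [tnu lo hi]] := mu_lower_bounds n_ge2 e_sym e_irr e_trans Qf.
rewrite muP ge_max; apply/andP; split.
  apply: le_trans lo; rewrite lerD2l lerN2 [leRHS]mulrC ler_wpM2r //.
  by rewrite -[X in _ <= X]mul1r ler_pdivlMr.
rewrite ler_pdivrMr //.
(* The combination b (1 - t a) + a (t b - 1) = b - a is free of t and is at most (b + a) mu(Q). *)
have := ler_wpM2l (ltW b0) lo; have := ler_wpM2l a0 hi; rewrite -/a -/b.
lra.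
Qed.
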